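(* Let $X$ be an infinite-dimensional Banach space and let $\Lambda\leq X$ be a cobounded lattice, and consider the Diophantine space $(X,\mathbb{Q}\Lambda,H_{\mathrm{std}})$. With $\psi_1(q)=1/q$, the set $\mathrm{BA}_{\psi_1}$ is prevalent. In particular, the Hausdorff dimension of $\mathrm{BA}_{\psi_1}$ is $+\infty$.
   Context: Banach spaces are real. A lattice in a Banach space $X$ is a subgroup $\Lambda\leq X$ which is topologically discrete (equivalently $\min_{p\in\Lambda\setminus\{0\}}\|p\|>0$) and such that $\mathbb{R}\Lambda$ is dense in $X$, or equivalently, no proper closed subspace of $X$ contains $\Lambda$. $\Lambda$ is cobounded if its codiameter $\mathrm{codiam}(\Lambda):=\sup\{\mathrm{dist}(x,\Lambda):x\in X\}$ is finite. $\mathbb{Q}\Lambda=\{p/q:p\in\Lambda,q\in\mathbb{N}\}$ with $\mathbb{N}=\{1,2,\ldots\}$, and $H_{\mathrm{std}}(r)=\min\{q\in\mathbb{N}:qr\in\Lambda\}$ for $r\in\mathbb{Q}\Lambda$. For $\psi:(0,+\infty)\to(0,+\infty)$, $\mathrm{BA}_\psi$ is the set of $x\in X$ for which there exists $\varepsilon>0$ such that $\|r-x\|\geq\varepsilon\,\psi(H_{\mathrm{std}}(r))$ for all $r\in\mathbb{Q}\Lambda$. A (Borel) measure $\mu$ on $X$ is transverse to a set $S\subset X$ if $\mu(S+v)=0$ for all $v\in X$; $S$ is shy if it is transverse to some compactly supported probability measure, and prevalent if its complement is shy. *)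

(* Defs.v *)
From HB Require Import structures.
From mathcomp Require Import all_boot all_order all_algebra.
From mathcomp Require Import all_classical all_reals all_analysis.
Import Order.TTheory GRing.Theory Num.Theory.
Import numFieldNormedType.Exports.

Set Implicit Arguments.
Unset Strict Implicit.
Unset Printing Implicit Defensive.

Local Open Scope classical_set_scope.
Local Open Scope ring_scope.

Section linear.
Context {R : realType} {X : normedModType R}.

Definition linear_span (A : set X) : set X :=
  [set x | exists n (c : 'I_n -> R) (p : 'I_n -> X),
    (forall i, A (p i)) /\ x = \sum_(i < n) c i *: p i].

End linear.

Definition infinite_dimensional (R : realType) (X : normedModType R) : Prop :=
  forall A : set X, finite_set A -> linear_span A <> [set: X].

(* On a normed module the library's extended distance is the norm distance,
   so [edist] and [edist_inf] below have their usual metric meaning. *)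
Lemma edist_normE (R : realType) (X : normedModType R) (x y : X) :
  edist (x, y) = `|x - y|%:E.
Proof.
apply/eqP; rewrite eq_le; apply/andP; split.
- apply/lee_addgt0Pr => e e0; rewrite -EFinD; apply: ereal_inf_lbound.
  exists (`|x - y| + e) => //=; split; first exact: ltr_wpDl.
  by rewrite -ball_normE /ball_ /= ltrDl.
- apply: le_ereal_inf_tmp => _ [r [r0 xy]] <-.
  by move: xy; rewrite lee_fin -ball_normE /ball_ /= => /ltW.
Qed.

Section lattice.
Context {R : realType} {X : normedModType R}.
Implicit Types (L : set X) (psi : R -> R).

Definition is_lattice L : Prop :=
  [/\ zmod_closed (mem L), L `<=` isolated L & dense (linear_span L)].

Definition codiam L : \bar R := ereal_sup [set edist_inf L x | x in [set: X]].

Definition cobounded L : Prop := (codiam L < +oo)%E.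

(* The set of rational points Q L. *)
Definition rational_points L : set X :=
  [set r | exists p (q : nat), [/\ L p, (0 < q)%N & r = q%:R^-1 *: p]].

(* Least q >= 1 with q r in L; the default 0 is only reached when r is not
   a rational point. *)
Definition Hstd L (r : X) : nat :=
  xget 0%N [set q | [/\ (0 < q)%N, L (r *+ q) &
                        forall q', (0 < q')%N -> L (r *+ q') -> (q <= q')%N]].

(* [psi] is only ever evaluated at integers >= 1. *)
Definition BA L psi : set X :=
  [set x | exists2 eps, 0 < eps &
    forall r, rational_points L r -> eps * psi (Hstd L r)%:R <= `|r - x|].

End lattice.

Section prevalence.
Context {R : realType} {X : normedModType R}.

(* The Borel sigma-algebra of X is the one generated by its open sets. *)
Definition borel_probability := probability (g_sigma_algebraType (@open X)) R.

Implicit Types (mu : borel_probability) (S : set X).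

(* Nullity is [negligible] (inclusion in a null Borel set) because a library
   measure takes arbitrary values on non-measurable sets; on Borel sets this
   is exactly mu (S + v) = 0. *)
Definition transverse mu S : Prop :=
  forall v : X, mu.-negligible [set x + v | x in S].

Definition compactly_supported mu : Prop :=
  exists2 K : set X, compact K & mu K = 1%E.

Definition shy S : Prop :=
  exists mu : borel_probability, compactly_supported mu /\ transverse mu S.

Definition prevalent S : Prop := shy (~` S).

End prevalence.

Section hausdorff.
Context {R : realType} {X : normedModType R}.
Implicit Types (s delta : R) (A S : set X).
Local Open Scope ereal_scope.

(* The diameter of the empty set is -oo, which does not affect the
   constraint [diam A <= delta] on covers. *)
Definition diam A : \bar R :=
  ereal_sup [set edist z | z in [set z | A z.1 /\ A z.2]].

(* (diam A)^s, with 0^0 = 1 for nonempty A and contribution 0 of set0. *)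
Definition diam_power s A : \bar R := if A == set0 then 0 else diam A `^ s.

Definition hausdorff_content s delta S : \bar R :=
  ereal_inf [set \sum_(0 <= k <oo) diam_power s (U k) |
    U in [set U : (set X)^nat |
           S `<=` \bigcup_k U k /\ forall k, diam (U k) <= delta%:E]].

Definition hausdorff_measure s S : \bar R :=
  ereal_sup [set hausdorff_content s delta S | delta in [set d : R | (0 < d)%R]].

Definition hausdorff_dim S : \bar R :=
  ereal_inf [set s%:E | s in [set s : R | (0 <= s)%R /\
                                          hausdorff_measure s S = 0]].

End hausdorff.

(* Main.v *)
Require Import Defs.
From HB Require Import structures.
From mathcomp Require Import all_boot all_order all_algebra.
From mathcomp Require Import all_classical all_reals all_analysis.
From mathcomp Require Import ring lra zify.
Import Order.TTheory GRing.Theory Num.Theory.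
Import numFieldNormedType.Exports.

(** Write [a] for [1 / 16]. A point [x] lies in [BA] for [psi q = 1 / q] as soon
    as the points [q x], [q >= 1], stay at a distance from [L] bounded below.
    Infinite dimension provides, by Riesz's lemma, a sequence [z] in the unit
    ball whose terms are [1 / 2]-separated. The test measure is the law of the
    random series [c * \sum_N a ^ N * z (j_(N+1))], where [j_N] is the index of
    the cell of a uniform variable [u] in the partition of the unit interval
    into [16 ^ (N (N + 1))] equal cells. This law is carried by a continuous
    image of a product of finite sets, hence by a compact set.

    Fix a translation [v], a level [N], a dilation [q < 16 ^ (N + 1)] and two
    values of [u] with the same [j_N] but distinct [j_(N+1)]. The two values of
    [x] differ by a vector of norm between [c a ^ N / 4] and [3 c a ^ N]
    ([point_close], [point_apart]). After dilation by [q], this difference is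
    too short to join two lattice points, if [c] is small compared with the
    minimal norm of [L]; so at most one of the two points [q (x - v)] is within
    [c q a ^ N / 8] of [L]. Hence each cell of level [N] has at most one subcell
    that is bad for [q] ([near_lattice_one_subcell]), among
    [16 ^ (2 (N + 1))], and the probability that some [q < 16 ^ (N + 1)] is bad
    at level [N] is at most [16 ^ (N + 1) * a ^ (2 (N + 1)) = a ^ (N + 1)]
    ([law_bad]). By the Borel-Cantelli lemma almost surely all levels from some
    [n] on are good, and then [x - v] lies in [BA], since every [q] is less than
    [16 ^ (N + 1)] for some [N >= n] with [a ^ n <= q a ^ N] ([not_BA_bad]).

    The same measure gives the dimension by the mass distribution principle:
    points in distinct cells of level [N + 1] are at least [c a ^ N / 4] apart,
    while such a cell has mass [a ^ ((N + 1) (N + 2))], so that the mass of a set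
    decays faster than every power of its diameter ([mass_decay]), whereas [BA]
    has full measure. *)

Set Implicit Arguments.
Unset Strict Implicit.
Unset Printing Implicit Defensive.

Local Open Scope classical_set_scope.
Local Open Scope ring_scope.

(** * Separated sequences in infinite-dimensional spaces *)

Section separated.
Context {R : realType} {X : normedModType R}.
Implicit Types (s : seq X) (x y v : X).

(** The recursion adds one direction at a time, which is how closedness is
    proved. *)
Fixpoint spanned s : set X :=
  if s is v :: s' then [set x | exists t : R, spanned s' (x - t *: v)]
  else [set 0].

Lemma spanned0 s : spanned s 0.
Proof. by elim: s => //= v s IHs; exists 0; rewrite scale0r subr0. Qed.

Lemma spannedP s a x y : spanned s x -> spanned s y -> spanned s (a *: x + y).
Proof.
elim: s x y => [|v s IHs] x y /=.
  by move=> -> ->; rewrite scaler0 addr0.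
move=> [t xt] [t' yt']; exists (a * t + t').
have -> : a *: x + y - (a * t + t') *: v =
    a *: (x - t *: v) + (y - t' *: v).
  rewrite scalerBr scalerDl opprD scalerA.
  by rewrite -!addrA; congr (_ + _); rewrite addrCA.
exact: IHs.
Qed.

Lemma spannedZ s a x : spanned s x -> spanned s (a *: x).
Proof. by move=> sx; rewrite -[_ *: _]addr0; apply: spannedP => //; exact: spanned0. Qed.

Lemma spanned_mem s x : x \in s -> spanned s x.
Proof.
elim: s => //= v s IHs; rewrite inE => /predU1P[->|/IHs sx].
  by exists 1; rewrite scale1r subrr; exact: spanned0.
by exists 0; rewrite scale0r subr0.
Qed.

Lemma spanned_linear_span s : spanned s `<=` linear_span [set` s].
Proof.
move=> x sx; suff [c ->] : exists c : 'I_(size s) -> R,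
    x = \sum_i c i *: tnth (in_tuple s) i.
  by exists (size s), c, (tnth (in_tuple s)); split => // i; exact: mem_tnth.
elim: s x sx => [x -> /=|v s IHs x /= [t /IHs[c xc]]].
  by exists (fun=> 0); rewrite big_ord0.
exists (fun i => if unlift ord0 i is Some j then c j else t).
rewrite big_ord_recl unlift_none /=.
rewrite [tnth _ ord0](tnth_nth v) /=.
apply/eqP; rewrite addrC -subr_eq xc; apply/eqP.
apply: eq_bigr => i _; rewrite liftK; congr (_ *: _).
by rewrite !(tnth_nth v).
Qed.

(** Adding one direction [v] to a closed subspace [F] keeps it closed: when
    [v] lies at distance at least [e] from [F], the coefficient of [v] is a
    Lipschitz function of the vector, so that the coefficients along a
    convergent sequence converge. *)
Lemma closed_spanned s : closed (spanned s).
Proof.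
elim: s => [|v s IHs] /=.
  by apply: accessible_closed_set1; apply: hausdorff_accessible; exact: norm_hausdorff.
have [sv|nsv] := pselect (spanned s v).
  rewrite (_ : mkset _ = spanned s)//; apply/seteqP; split => [x [t xt]|x sx] /=.
    by rewrite -(subrK (t *: v) x) addrC; exact: spannedP.
  by exists 0; rewrite scale0r subr0.
have /nbhs_ballP[e /= e0 ve] : nbhs v (~` spanned s).
  by apply: open_nbhs_nbhs; split => //; exact: closed_openC.
have coefP t y : spanned s y -> `|t| * e <= `|t *: v - y|.
  move=> sy; have [->|t0] := eqVneq t 0; first by rewrite normr0 mul0r.
  have -> : t *: v - y = t *: (v - t^-1 *: y).
    by rewrite scalerBr scalerA divff// scale1r.
  rewrite normrZ ler_pM2l ?normr_gt0// leNgt; apply/negP => ve'.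
  by apply: (ve (t^-1 *: y)); [rewrite -ball_normE|exact: spannedZ].
move=> x clx.
have /choice[u uP] n : exists u : R * X, spanned s u.2 /\
    `|x - (u.1 *: v + u.2)| < n.+1%:R^-1.
  have /clx[y [[t ty] xy]] : nbhs x (ball x (n.+1%:R^-1 : R)).
    by apply: nbhsx_ballx; rewrite invr_gt0.
  exists (t, y - t *: v); split => //=.
  have -> : t *: v + (y - t *: v) = y by rewrite addrC subrK.
  by move: xy; rewrite -ball_normE.
have cu : cvgn (fun n => (u n).1).
  apply/cauchy_cvgP/cauchy_exP => d d0.
  pose N := Num.truncn (2 / (d * e)).
  exists (u N).1, N => // n /= Nn.
  have [sn xn] := uP n; have [sN xN] := uP N.
  rewrite -ball_normE /ball_/= -(ltr_pM2r e0).
  apply: (@le_lt_trans _ _ (N.+1%:R^-1 + n.+1%:R^-1)).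
    apply: (le_trans (coefP _ ((u n).2 - (u N).2) _)).
      by rewrite addrC -scaleN1r; exact: spannedP.
    have -> : ((u N).1 - (u n).1) *: v - ((u n).2 - (u N).2) =
       (x - ((u n).1 *: v + (u n).2)) - (x - ((u N).1 *: v + (u N).2)).
      by rewrite scalerBl !opprB [RHS]addrC subrKA opprD addrACA.
    by rewrite (le_trans (ler_normB _ _))// addrC lerD// ltW.
  have de : N.+1%:R^-1 < d * e / 2.
    rewrite invf_plt ?posrE ?divr_gt0 ?mulr_gt0// invf_div.
    exact: truncnS_gt.
  have nN : n.+1%:R^-1 <= N.+1%:R^-1 :> R.
    by rewrite lef_pV2 ?posrE// ler_nat ltnS.
  by rewrite (splitr (d * e)) ltrD// (le_lt_trans nN).
exists (limn (fun n => (u n).1)).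
apply: (@closed_cvg _ _ \oo _ (fun n => x - (u n).1 *: v - (x - ((u n).1 *: v + (u n).2))) _ IHs).
  near=> n; have [sn _] := uP n.
  by rewrite opprB addrC subrKA addrAC subrr add0r.
rewrite -[X in _ --> X]subr0; apply: cvgB.
  apply: cvgB; first exact: cvg_cst.
  by apply: cvgZr_tmp.
apply/cvgrPdist_lt => d d0; near=> n.
rewrite sub0r normrN; have [_ xn] := uP n; apply: (lt_trans xn).
near: n.
exact: near_infty_natSinv_lt (PosNum d0).
Unshelve. all: end_near. Qed.

(** Riesz's lemma: rescale [x - f], where [f] in the span nearly realizes the
    distance from a point [x] off the span. *)
Lemma riesz s : spanned s <> [set: X] ->
  exists z : X, `|z| = 1 /\ forall y, spanned s y -> 1 / 2 <= `|z - y|.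
Proof.
move=> /eqP/setTPn[x nsx].
have /nbhs_ballP[e /= e0 xe] : nbhs x (~` spanned s).
  by apply: open_nbhs_nbhs; split => //; exact/closed_openC/closed_spanned.
pose D := [set `|x - y| | y in spanned s].
have De r : D r -> e <= r.
  move=> [y sy <-]; rewrite leNgt; apply/negP => xy.
  by apply: (xe y) sy; rewrite -ball_normE.
have hD : has_inf D.
  split; first by exists `|x - 0|, 0 => //; exact: spanned0.
  by exists e => r; exact: De.
have D0 : 0 < inf D by apply: (lt_le_trans e0); apply: lb_le_inf => //; exact: hD.1.
have [_ [f sf <-]] := inf_adherent D0 hD; set r := `|x - f| => fD.
have r0 : 0 < r by apply: (lt_le_trans e0); apply: De; exists f.
exists (r^-1 *: (x - f)); split.
  by rewrite normrZ gtr0_norm ?invr_gt0// -/r mulVf// gt_eqF.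
move=> y sy.
have -> : r^-1 *: (x - f) - y = r^-1 *: (x - (r *: y + f)).
  by rewrite !scalerBr scalerDr scalerA mulVf ?gt_eqF// scale1r opprD addrA addrAC.
rewrite normrZ gtr0_norm ?invr_gt0// ler_pdivlMl//.
have : inf D <= `|x - (r *: y + f)|.
  by apply: inf_lbound; [exact: hD.2|exists (r *: y + f) => //; exact: spannedP].
lra.
Qed.

(** Each term is a vector of Riesz's lemma for the span of the previous ones. *)
Lemma separated_sequence : infinite_dimensional X ->
  exists z : nat -> X, (forall i, `|z i| <= 1) /\
    forall i j, i != j -> 1 / 2 <= `|z i - z j|.
Proof.
move=> Xinf.
have /choice[g gP] s : exists z : X, `|z| = 1 /\
    forall y, spanned s y -> 1 / 2 <= `|z - y|.
  apply: riesz => sT; apply: (Xinf [set` s]); first exact: finite_seq.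
  by apply/seteqP; split => // x _; apply: spanned_linear_span; rewrite sT.
pose s := fix s n := if n is n'.+1 then g (s n') :: s n' else [::].
have mem i j : (i < j)%N -> g (s i) \in s j.
  elim: j => // j IHj; rewrite ltnS leq_eqVlt inE => /predU1P[->|/IHj ->].
    by rewrite eqxx.
  by rewrite orbT.
exists (g \o s); split => [i|i j ij] /=; first by rewrite (gP _).1.
wlog ji : i j ij / (j < i)%N.
  move=> H; have [|ij'|ij'] := ltngtP j i; first exact: H.
    by rewrite distrC; apply: H => //; rewrite eq_sym.
  by rewrite ij' eqxx in ij.
by apply: (gP _).2; apply: spanned_mem; exact: mem.
Qed.

End separated.

(** * Nested cells in a probability space *)

Section cells.
Context {R : realType}.

(** The ratio [16 ^ (2 * N.+1)] of two consecutive terms outgrows the number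
    [16 ^ N.+1] of dilations to be avoided at level [N]. *)
Definition nb_cells N : nat := 16 ^ (N * N.+1).

(** On the unit interval this is the index of the interval of length
    [1 / nb_cells N] containing [u]; the reduction modulo [nb_cells N] confines
    the index sequences to a product of finite sets for every real [u]. *)
Definition cell N (u : R) : nat := Num.truncn ((nb_cells N)%:R * u) %% nb_cells N.

Lemma nb_cells_gt0 N : (0 < nb_cells N)%N.
Proof. by rewrite expn_gt0. Qed.

Lemma nb_cellsS N : nb_cells N.+1 = (nb_cells N * 16 ^ (2 * N.+1))%N.
Proof. by rewrite /nb_cells -expnD; congr (16 ^ _)%N; lia. Qed.

Lemma cell_lt N u : (cell N u < nb_cells N)%N.
Proof. by rewrite ltn_mod nb_cells_gt0. Qed.

Lemma truncn_divn (u : R) m : (0 < m)%N ->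
  Num.truncn u = (Num.truncn (m%:R * u) %/ m)%N.
Proof.
move=> m0; have [u0|u0] := ltP u 0.
  have trunc0 (v : R) : v < 0 -> Num.truncn v = 0%N.
    by move=> v0; apply/truncn0Pn; rewrite -ltNge (lt_trans v0).
  by rewrite !trunc0 ?div0n// nmulr_llt0// ltr0n.
have mu0 : 0 <= m%:R * u by rewrite mulr_ge0.
apply/eqP; rewrite truncn_eq//; apply/andP; split.
  rewrite -(ler_pM2l (_ : 0 < m%:R)) ?ltr0n// -natrM -truncn_ge_nat//.
  by rewrite mulnC leq_trunc_div.
rewrite -(ltr_pM2l (_ : 0 < m%:R)) ?ltr0n// -natrM -truncn_lt_nat//.
by rewrite mulnC ltn_ceil.
Qed.

Lemma cell_refine N u u' : cell N.+1 u = cell N.+1 u' -> cell N u = cell N u'.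
Proof.
have cellE v : cell N v = (cell N.+1 v %/ 16 ^ (2 * N.+1))%N.
  rewrite /cell nb_cellsS -modn_divl; congr (_ %% _)%N.
  rewrite (@truncn_divn _ (16 ^ (2 * N.+1))) ?expn_gt0//.
  by rewrite mulrA -natrM mulnC.
by rewrite !cellE => ->.
Qed.

Lemma measurable_truncn : measurable_fun setT (@Num.truncn R).
Proof.
move=> _ Y _; rewrite setTI.
have -> : Num.truncn @^-1` Y = \bigcup_(i in Y) (Num.truncn @^-1` [set i] : set R).
  apply/seteqP; split => [u Yu|u [i Yi ui]]; first by exists (Num.truncn u).
  by rewrite /preimage/= (ui : Num.truncn u = i).
apply: bigcup_measurable => -[|i] Yi.
  have -> : Num.truncn @^-1` [set 0%N] = `]-oo, 1[%classic :> set R.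
    apply/seteqP; split => u /=; rewrite in_itv/=.
      by move=> /truncn0Pn; rewrite -ltNge.
    by move=> u1; apply/truncn0Pn; rewrite -ltNge.
  exact: measurable_itv.
have -> : Num.truncn @^-1` [set i.+1] = `[i.+1%:R, i.+2%:R[%classic :> set R.
  apply/seteqP; split => u /=; rewrite in_itv/=; last exact: truncn_def.
  move=> ui.
  rewrite -ui truncn_itv// ltW// (lt_le_trans ltr01)//.
  by rewrite -truncn_gt0 ui.
exact: measurable_itv.
Qed.

Lemma measurable_cell N (Y : set nat) : measurable (cell N @^-1` Y).
Proof.
rewrite -[X in measurable X]setTI.
apply: (measurableT_comp (f := fun n => n %% nb_cells N)%N) => //.
apply: (measurableT_comp measurable_truncn).
exact: measurable_realfun.mulrl_measurable.
Qed.

Definition unif01 : set (measurableTypeR R) -> \bar R :=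
  mrestr (@lebesgue_measure R) (measurable_itv `[0, 1[).

HB.instance Definition _ := Measure.on unif01.

Lemma unif01_setT : unif01 setT = 1%E.
Proof.
by rewrite /unif01 /mrestr setTI lebesgue_measure_itv/= lte01 sube0.
Qed.

HB.instance Definition _ := Measure_isProbability.Build _ _ R unif01 unif01_setT.

Lemma unif01_cell N i : (unif01 (cell N @^-1` [set i]) <= (nb_cells N)%:R^-1%:E)%E.
Proof.
set k := nb_cells N; have k0 : 0 < k%:R :> R by rewrite ltr0n nb_cells_gt0.
pose I : set R := `[i%:R / k%:R, i.+1%:R / k%:R[%classic.
have -> : (k%:R^-1)%:E = lebesgue_measure I.
  rewrite lebesgue_measure_itv/= lte_fin ltr_pM2r ?invr_gt0// ltr_nat leqnn.
  by rewrite -EFinD -mulrBl -natrB// subSnn mul1r.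
rewrite /unif01 /mrestr; apply: le_measure; rewrite ?inE.
- by apply: measurableI; [exact: measurable_cell|exact: measurable_itv].
- exact: measurable_itv.
move=> u [/= ui]; rewrite /= in_itv/= => /andP[u0 u1].
have ku0 : 0 <= k%:R * u by rewrite mulr_ge0// ltW.
rewrite /I/= in_itv/= ler_pdivrMr// ltr_pdivlMr// mulrC.
move: ui; rewrite /cell modn_small; last first.
  by rewrite truncn_lt_nat// gtr_pMr.
by move=> <-; exact: truncn_itv.
Qed.

End cells.

(** * Coding cells by points of the space *)

Section coding.
Context {R : realType} {X : completeNormedModType R}.
Local Notation a := (16^-1 : R).

Lemma is_cvg_scaled_series (w : nat -> X) b : (forall i, `|w i| <= b) ->
  cvgn (series (fun i => a ^+ i *: w i)).
Proof.
move=> wb; apply: normed_cvg.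
have a1 : `|a| < 1 by rewrite gtr0_norm ?invr_gt0// invf_lt1// ltr1n.
apply: series_le_cvg (is_cvg_geometric_series (a := b) a1) => n.
- exact: normr_ge0.
- by rewrite /geometric/= mulr_ge0// (le_trans _ (wb 0%N)).
- rewrite /geometric/= normrZ normrX gtr0_norm ?invr_gt0//.
  by rewrite mulrC ler_wpM2r.
Qed.

Lemma scaled_series_tail (w : nat -> X) k : (forall i, `|w i| <= 2) ->
  `|limn (series (fun i => a ^+ i *: w i)) - \sum_(i < k) a ^+ i *: w i|
    <= 32 / 15 * a ^+ k.
Proof.
move=> w2; set S := series _.
have Sk n : `|S (n + k)%N - \sum_(i < k) a ^+ i *: w i| <=
    32 / 15 * (a ^+ k - a ^+ (n + k)).
  elim: n => [|n IHn]; first by rewrite add0n /S seriesEord subrr normr0 subrr mulr0.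
  have -> : S (n.+1 + k)%N = S (n + k)%N + a ^+ (n + k) *: w (n + k)%N.
    by rewrite addSn /S !seriesEord /= big_ord_recr.
  rewrite addrAC (le_trans (ler_normD _ _))// addSn exprS.
  have : `|a ^+ (n + k) *: w (n + k)%N| <= a ^+ (n + k) * 2.
    by rewrite normrZ gtr0_norm ?exprn_gt0 ?invr_gt0// ler_pM2l ?exprn_gt0 ?invr_gt0.
  move: IHn; set x := `|_ - _|; set y := `|_ *: _|; move: x y => x y.
  by move: (a ^+ k) (a ^+ (n + k)) => p q; lra.
have cS : S (n + k)%N - \sum_(i < k) a ^+ i *: w i @[n --> \oo] -->
    limn S - \sum_(i < k) a ^+ i *: w i.
  apply: cvgB; last exact: cvg_cst.
  by have := is_cvg_scaled_series w2; rewrite -/S -(cvg_shiftn k).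
apply: (cvgr_to_le (cvg_norm cS)); near=> n.
rewrite (le_trans (Sk n))// ler_pM2l; last lra.
by rewrite gerBl exprn_ge0// invr_ge0.
Unshelve. all: end_near. Qed.

Variables (c : R) (z : nat -> X).
Hypotheses (c0 : 0 < c) (z1 : forall i, `|z i| <= 1)
  (zsep : forall i j, i != j -> 1 / 2 <= `|z i - z j|).

Definition code (d : nat -> nat) : X :=
  c *: limn (series (fun i => a ^+ i *: z (d i))).

Lemma code_tail d d' k :
  `|code d - code d' - c *: \sum_(i < k) a ^+ i *: (z (d i) - z (d' i))|
    <= c * (32 / 15 * a ^+ k).
Proof.
rewrite /code -!scalerBr normrZ gtr0_norm// ler_pM2l//.
have w2 i : `|z (d i) - z (d' i)| <= 2.
  by rewrite (le_trans (ler_normB _ _))// (_ : 2 = 1 + 1)// lerD.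
have cz e : cvgn (series (fun i => a ^+ i *: z (e i))).
  by apply: (@is_cvg_scaled_series _ 1) => i; exact: z1.
rewrite -(limB (cz d) (cz d')).
rewrite (_ : _ - _ = series (fun i => a ^+ i *: (z (d i) - z (d' i)))).
  exact: scaled_series_tail.
apply/funext => n; rewrite addrfctE opprfctE !seriesEord -sumrB.
by apply: eq_bigr => i _; rewrite scalerBr.
Qed.

Lemma code_close d d' k : (forall i, (i < k)%N -> d i = d' i) ->
  `|code d - code d'| <= 3 * c * a ^+ k.
Proof.
move=> dd'; have := code_tail d d' k.
rewrite big1 ?scaler0 ?subr0 => [|i _]; last by rewrite dd'// subrr scaler0.
move=> /le_trans; apply; rewrite mulrA ler_pM2r ?exprn_gt0 ?invr_gt0//.
by rewrite mulrC ler_pM2r//; lra.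
Qed.

(** The first differing term outweighs the tail: [1 / 2] against
    [32 / 15 / 16]. *)
Lemma code_apart d d' k : (forall i, (i < k)%N -> d i = d' i) -> d k != d' k ->
  c / 4 * a ^+ k <= `|code d - code d'|.
Proof.
move=> dd' /zsep dk; have := code_tail d d' k.+1.
rewrite big_ord_recr/= big1 ?add0r => [|i _]; last by rewrite dd'// subrr scaler0.
set D := code d - code d'; set T := c *: _ => DT.
have : c * a ^+ k / 2 <= `|T|.
  rewrite /T !normrZ !gtr0_norm ?exprn_gt0 ?invr_gt0// -!mulrA ler_pM2l//.
  rewrite ler_pM2l ?exprn_gt0 ?invr_gt0//.
  by move: dk; rewrite mul1r.
have : `|T| <= `|D| + `|D - T|.
  by rewrite -{1}(subKr D T) (le_trans (ler_normB _ _)).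
have : c * (32 / 15 * a ^+ k.+1) = c * a ^+ k * (2 / 15) by rewrite exprS; field.
move: DT => /[swap] ->; set e := c * a ^+ k.
have e0 : 0 < e by rewrite mulr_gt0// exprn_gt0 ?invr_gt0.
rewrite (_ : c / 4 * a ^+ k = e / 4); last by rewrite mulrAC.
move: e0; move: `|D| `|T| `|D - T| e => x y t e; lra.
Qed.

(** * The test measure *)

(** The index of the term of rank [i] is the index of the whole cell of level
    [i.+1], not only the last digit of its expansion; so two parameters leaving
    a common cell have distinct indices from that rank on. *)
Definition point (u : R) : X := code (fun i => cell i.+1 u).

Lemma cell_leq m n (u u' : R) : (m <= n)%N -> cell n u = cell n u' ->
  cell m u = cell m u'.
Proof.
elim: n => [|n IHn]; first by rewrite leqn0 => /eqP->.
by rewrite leq_eqVlt => /predU1P[->//|mn] /cell_refine; exact: IHn.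
Qed.

Lemma point_close k (u u' : R) : cell k u = cell k u' ->
  `|point u - point u'| <= 3 * c * a ^+ k.
Proof. by move=> uu'; apply: code_close => i ik; exact: cell_leq uu'. Qed.

(** Only the first rank where the cells differ matters, and it is at most
    [k]. *)
Lemma point_apart k (u u' : R) : cell k.+1 u != cell k.+1 u' ->
  c / 4 * a ^+ k <= `|point u - point u'|.
Proof.
have ca := @code_apart (fun i => cell i.+1 u) (fun i => cell i.+1 u').
elim: k => [|k IHk] uu'; first by apply: ca.
have [uu'k|uu'k] := eqVneq (cell k.+1 u) (cell k.+1 u').
  by apply: ca => // i ik; exact: cell_leq uu'k.
rewrite (le_trans _ (IHk uu'k))// ler_pM2l ?divr_gt0// exprS.
by rewrite ger_pMl ?exprn_gt0 ?invr_gt0// invf_le1// ler1n.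
Qed.

Local Notation borelX := (g_sigma_algebraType (@open X)).

(** The preimage of an open set [U] is the union over [k] of the unions of
    cells of level [k] that [point] maps into [U]. *)
Lemma measurable_point :
  measurable_fun setT (point : measurableTypeR R -> borelX).
Proof.
apply: (@measurability _ _ (measurableTypeR R) borelX setT point (@open X)) => //.
move=> _ [U oU <-]; rewrite setTI.
have -> : point @^-1` U = \bigcup_k
    (cell k @^-1` [set i | cell k @^-1` [set i] `<=` point @^-1` U]).
  apply/seteqP; split => [u Uu|u [k _ /= ]]; last exact.
  have /nbhs_ballP[e /= e0 eU] : nbhs (point u) U by exact: open_nbhs_nbhs.
  have a1 : `|a| < 1 by rewrite gtr0_norm ?invr_gt0// invf_lt1// ltr1n.
  have /cvgrPdist_lt/(_ _ e0)[k _ /(_ k (leqnn _))/=] := cvg_geometric (3 * c) a1.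
  rewrite sub0r normrN /= gtr0_norm ?mulr_gt0 ?exprn_gt0 ?invr_gt0// => ke.
  exists k => // u' /= u'u; apply: eU; rewrite -ball_normE/=.
  by apply: le_lt_trans ke; exact: point_close.
by apply: bigcup_measurable => k _; exact: measurable_cell.
Qed.

(** Tychonoff's theorem applies to the admissible index sequences, and
    [code] is continuous for the product topology. *)
Lemma compact_code :
  compact (code @` [set d | forall i, (d i < nb_cells i.+1)%N]).
Proof.
pose T := prod_topology (fun _ : nat => nat).
apply: (@continuous_compact T).
  apply: continuous_subspaceT => d.
  apply/cvgrPdist_lt => e e0.
  have a1 : `|a| < 1 by rewrite gtr0_norm ?invr_gt0// invf_lt1// ltr1n.
  have /cvgrPdist_lt/(_ _ e0)[k _ /(_ k (leqnn _))/=] := cvg_geometric (3 * c) a1.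
  rewrite sub0r normrN /= gtr0_norm ?mulr_gt0 ?exprn_gt0 ?invr_gt0// => ke.
  have agree : \forall d' \near (d : T), forall i, (i < k)%N -> d i = d' i.
    elim: k {ke} => [|k IHk]; first by near=> d'.
    near=> d' => i; rewrite ltnS leq_eqVlt => /predU1P[->|]; last by move: i; near: d'.
    near: d'; apply: (@proj_continuous nat (fun _ => nat) k d [set n | d k = n]).
    by rewrite nbhs_principalE; exact/principal_filterP.
  near=> d'; apply: le_lt_trans ke; apply: code_close.
  by near: d'.
apply: (@tychonoff nat (fun _ => nat) (fun i => `I_(nb_cells i.+1))) => i.
by apply: finite_compact; exact: finite_II.
Unshelve. all: end_near. Qed.

Definition law : @borel_probability R X :=
  distribution (unif01 : probability (measurableTypeR R) R)
    (mfun_Sub (mem_set measurable_point)).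

Lemma lawE (A : set X) : law A = unif01 (point @^-1` A).
Proof. by []. Qed.

Lemma compactly_supported_law : compactly_supported law.
Proof.
exists (code @` [set d | forall i, (d i < nb_cells i.+1)%N]); first exact: compact_code.
rewrite lawE (_ : _ @^-1` _ = setT); first exact: unif01_setT.
apply/seteqP; split => // u _ /=.
by exists (fun i => cell i.+1 u) => // i; exact: cell_lt.
Qed.

End coding.

(** * Neighbourhoods of the dilated lattice are negligible *)

Section lattice_avoidance.
Context {R : realType} {X : completeNormedModType R}.
Local Notation a := (16^-1 : R).
Variables (c lambda : R) (z : nat -> X) (L : set X).
Hypotheses (c0 : 0 < c) (z1 : forall i, `|z i| <= 1)
  (zsep : forall i j, i != j -> 1 / 2 <= `|z i - z j|).
Hypotheses (L_zmod : zmod_closed (mem L))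
  (L_sep : forall p, L p -> `|p| < lambda -> p = 0) (c_le : 96 * c <= lambda).

Local Notation BA1 := (BA L (fun q : R => q^-1)).

Let a_gt0 N : 0 < a ^+ N.
Proof. by rewrite exprn_gt0 ?invr_gt0. Qed.

Let lattice_sub p p' : L p -> L p' -> L (p - p').
Proof.
move=> Lp Lp'; have : p - p' \in L by apply: L_zmod.2; rewrite inE.
by rewrite inE.
Qed.

(** Only one of the [16 ^ (2 * N.+1)] subcells of each cell of level [N] can
    contribute to [S]. *)
Lemma unif01_le_one_subcell N (S : set (measurableTypeR R)) : measurable S ->
  (forall u u', S u -> S u' -> cell N u = cell N u' ->
    cell N.+1 u = cell N.+1 u') ->
  (unif01 S <= (a ^+ (2 * N.+1))%:E)%E.
Proof.
move=> mS Scell.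
pose F i := S `&` cell N @^-1` [set i].
have mF i : measurable (F i) by apply: measurableI => //; exact: measurable_cell.
have SF : S `<=` \big[setU/set0]_(i < nb_cells N) F i.
  move=> u Su; rewrite -(bigcup_mkord (nb_cells N) F).
  by exists (cell N u); [exact: cell_lt|].
apply: (le_trans (content_subadditive unif01 (fun k _ => mF k) mS SF)).
apply: (@le_trans _ _ (\sum_(i < nb_cells N) ((nb_cells N.+1)%:R^-1)%:E)%E).
  apply: lee_sum => i _.
  have [->|/set0P[u0 [Su0 u0i]]] := eqVneq (F i) set0.
    by rewrite measure0 lee_fin invr_ge0.
  apply: le_trans (unif01_cell N.+1 (cell N.+1 u0)).
  apply: le_measure; rewrite ?inE//; first exact: measurable_cell.
  by move=> u [Su ui]; apply: Scell => //; rewrite (ui : cell N u = i) (u0i : cell N u0 = i).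
rewrite sumEFin lee_fin sumr_const card_ord nb_cellsS natrM invfM.
rewrite -[X in X <= _]mulr_natl mulrA divff ?mul1r ?natrX ?exprVn//.
Qed.

Definition near_lattice N q v : set X :=
  [set y | exists2 p, L p & `|q%:R *: (y - v) - p| < c / 8 * q%:R * a ^+ N].

Lemma near_lattice_open N q v : open (near_lattice N q v).
Proof.
rewrite (_ : near_lattice N q v = \bigcup_(p in L)
    ((fun y : X => `|q%:R *: (y - v) - p|) @^-1` [set r | r < c / 8 * q%:R * a ^+ N])).
  apply: bigcup_open => p _; apply: open_comp; last exact: open_lt.
  move=> y _; apply: (@continuous_comp _ _ _ (fun y => q%:R *: (y - v) - p)); last exact: norm_continuous.
  apply: cvgB; last exact: cvg_cst.
  by apply: cvgZl_tmp; apply: cvgB; [exact: cvg_id|exact: cvg_cst].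
by apply/seteqP; split => [y [p Lp yp]|y [p Lp yp]]; exists p.
Qed.

(** Two points coming from a common cell of level [N] but from distinct cells
    of level [N.+1] differ, after dilation by [q], by less than the minimal norm of the
    lattice; if both are near the lattice they are near the same lattice point,
    and then closer than distinct cells allow. The constant 96 leaves room for
    [q (3 c a ^ N) + c q a ^ N / 4], where [q a ^ N < 16]. *)
Lemma near_lattice_one_subcell N q v u u' : (0 < q < 16 ^ N.+1)%N ->
  near_lattice N q v (point c z u) -> near_lattice N q v (point c z u') ->
  cell N u = cell N u' -> cell N.+1 u = cell N.+1 u'.
Proof.
move=> /andP[q0 qN] [p Lp up] [p' Lp' up'] uu'; apply/eqP/negPn/negP => nuu'.
have := point_apart c0 z1 zsep nuu'; have := point_close c0 z1 uu'.
set D := point c z u - point c z u' => D_le D_ge.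
have q_gt0 : 0 < q%:R :> R by rewrite ltr0n.
have qa : q%:R * a ^+ N < 16.
  rewrite exprVn ltr_pdivrMr ?exprn_gt0// -natrX -natrM ltr_nat.
  by rewrite -expnS.
have qD : `|q%:R *: D - (p - p')| < c / 4 * (q%:R * a ^+ N).
  have -> : q%:R *: D - (p - p') =
      (q%:R *: (point c z u - v) - p) - (q%:R *: (point c z u' - v) - p').
    rewrite [in RHS](opprB _ p') [in RHS](addrC p') [RHS]addrACA.
    by rewrite -scalerBr !opprB subrKA [- p + _]addrC.
  apply: (le_lt_trans (ler_normB _ _)).
  rewrite (_ : c / 4 * _ = c / 8 * q%:R * a ^+ N + c / 8 * q%:R * a ^+ N); last by field.
  exact: ltrD.
have nqD : `|q%:R *: D| = q%:R * `|D| by rewrite normrZ gtr0_norm.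
have pp' : p - p' = 0.
  apply: L_sep; first exact: lattice_sub.
  have := ler_normB (q%:R *: D) (q%:R *: D - (p - p')); rewrite subKr nqD.
  have : q%:R * `|D| <= q%:R * (3 * c * a ^+ N) by rewrite ler_pM2l.
  have : c * (q%:R * a ^+ N) <= c * 16 by rewrite ler_pM2l// ltW.
  have -> : q%:R * (3 * c * a ^+ N) = 3 * (c * (q%:R * a ^+ N)) by ring.
  have E : c / 4 * (q%:R * a ^+ N) = (c * (q%:R * a ^+ N)) / 4 by rewrite mulrAC.
  move: qD c_le; rewrite E.
  have aux (t y x w : R) : 0 < c -> y < w / 4 -> 96 * c <= lambda -> w <= c * 16 ->
    x <= 3 * w -> t <= x + y -> t < lambda by lra.
  exact: aux c0.
move: qD; rewrite pp' subr0 nqD ltNge => /negP; apply.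
by rewrite mulrCA ler_pM2l.
Qed.

(** The bound on [q] keeps the dilated difference of two points coming from a
    common cell of level [N] shorter than the minimal norm of the lattice. *)
Definition bad N v : set X :=
  \bigcup_(q in [set q | 0 < q < 16 ^ N.+1]%N) near_lattice N q v.

Lemma bad_open N v : open (bad N v).
Proof. by apply: bigcup_open => q _; exact: near_lattice_open. Qed.

Local Notation P := (law c0 z1).

Lemma law_bad N v : (P (bad N v) <= (a ^+ N.+1)%:E)%E.
Proof.
pose F q := if (0 < q < 16 ^ N.+1)%N then near_lattice N q v else set0.
have mF q : measurable (F q : set (g_sigma_algebraType (@open X))).
  rewrite /F; case: ifP => // _; apply: sub_sigma_algebra.
  exact: near_lattice_open.
have mbad : measurable (bad N v : set (g_sigma_algebraType (@open X))).
  by apply: sub_sigma_algebra; exact: bad_open.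
have badF : bad N v `<=` \big[setU/set0]_(q < 16 ^ N.+1) F q.
  move=> y [q /= qN yq]; rewrite -(bigcup_mkord (16 ^ N.+1) F).
  by exists q => //=; [case/andP: qN|rewrite /F qN].
apply: (le_trans (content_subadditive P (fun k _ => mF k) mbad badF)).
apply: (@le_trans _ _ (\sum_(q < 16 ^ N.+1) (a ^+ (2 * N.+1))%:E)%E).
  apply: lee_sum => q _; rewrite /F; case: ifPn => qN; last first.
    by rewrite measure0 lee_fin ltW.
  apply: (@unif01_le_one_subcell N (point c z @^-1` near_lattice N q v)).
    rewrite -[X in measurable X]setTI; apply: measurable_point => //.
    by apply: sub_sigma_algebra; exact: near_lattice_open.
  by move=> u u'; exact: near_lattice_one_subcell.
rewrite sumEFin lee_fin sumr_const card_ord -[X in X <= _]mulr_natl mul2n -addnn exprD.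
by rewrite mulrA natrX -exprMn divff ?expr1n ?mul1r.
Qed.

Lemma law_lim_sup_bad v : P (lim_sup_set (fun N => bad N v)) = 0%E.
Proof.
apply: lim_sup_set_cvg0 => [N|]; first by apply: sub_sigma_algebra; exact: bad_open.
(* The series is dominated by the sum of the terms [1 / 2 ^ N.+1]. *)
apply: (@le_lt_trans _ _ 1%:E); last exact: ltry.
apply: le_trans (epsilon_trick0 xpredT ler01).
apply: lee_nneseries => // N _; rewrite (le_trans (law_bad N v))// lee_fin.
rewrite div1r natrX -exprVn lerXn2r ?nnegrE ?invr_ge0//.
by rewrite lef_pV2 ?posrE// ler_nat.
Qed.

(** A rational point [r] with denominator [q] too close to [x] makes [x + v] bad
    at every level [N >= n] with [q < 16 ^ N.+1] and [a ^ n <= q * a ^ N]. The level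
    is [n] for small [q], and otherwise the integer part of the logarithm of
    [q] to the base 16. *)
Lemma not_BA_bad v x : (~` BA1) x ->
  lim_sup_set (fun N => bad N v) (x + v).
Proof.
move=> nBA n _; apply: contrapT => nbad; apply: nBA.
exists (c / 8 * a ^+ n); first by rewrite mulr_gt0// divr_gt0.
(* The default value 0 of [Hstd] gives the trivial bound [0^-1 = 0]. *)
move=> r _; rewrite /Hstd; case: xgetP => [q _ [q0 Lrq _]|_]; last first.
  by rewrite invr0 mulr0.
have q_gt0 : 0 < q%:R :> R by rewrite ltr0n.
rewrite leNgt; apply/negP => rx; apply: nbad.
suff [N nN [qN aqa]] : exists2 N, (n <= N)%N & (q < 16 ^ N.+1)%N /\
    a ^+ n <= q%:R * a ^+ N.
  exists N => //; exists q => /=; first by rewrite q0.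
  exists (r *+ q) => //; rewrite addrK -(scaler_nat q r) -scalerBr normrZ gtr0_norm//.
  rewrite distrC mulrC -ltr_pdivlMr//; apply: (lt_le_trans rx).
  by rewrite ler_pM2r ?invr_gt0// -(mulrA (c / 8)) ler_pM2l ?divr_gt0.
have [qn|nq] := ltnP q (16 ^ n.+1).
  by exists n => //; split => //; rewrite ler_peMl ?ler1n// ltW.
have /= := trunc_log_bounds (isT : (1 < 16)%N) q0; set N := trunc_log _ _ => /andP[Nq qN].
exists N; first by have := leq_ltn_trans nq qN; rewrite ltn_exp2l// ltnS => /ltnW.
split => //; apply: (@le_trans _ _ 1); first by rewrite exprn_ile1// ?invr_ge0// invf_le1// ler1n.
by rewrite exprVn ler_pdivlMr ?exprn_gt0// mul1r -natrX ler_nat.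
Qed.

Lemma transverse_not_BA : transverse P (~` BA1).
Proof.
move=> v; exists (lim_sup_set (fun N => bad N v)); split.
- apply: bigcap_measurable => // n _; apply: bigcup_measurable => N _.
  by apply: sub_sigma_algebra; exact: bad_open.
- exact: law_lim_sup_bad.
- by move=> _ [x xBA <-]; exact: not_BA_bad.
Qed.

(** * Hausdorff dimension *)

(** Parameters whose points are within [r] of [point u0] lie in this set. All
    levels separated by more than [r] are imposed at once, so that the set is
    negligible when [r = 0]. *)
Let hull r (u0 : R) : set (measurableTypeR R) :=
  \bigcap_(N in [set N | r < c / 4 * a ^+ N]) cell N.+1 @^-1` [set cell N.+1 u0].

Let measurable_hull r u0 : measurable (hull r u0).
Proof.
by apply: bigcap_measurableType => N _; exact: measurable_cell.
Qed.

Let unif01_hull r u0 N : r < c / 4 * a ^+ N ->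
  (unif01 (hull r u0) <= (a ^+ (N.+1 * N.+2))%:E)%E.
Proof.
move=> rN; have -> : a ^+ (N.+1 * N.+2) = (nb_cells N.+1)%:R^-1.
  by rewrite natrX exprVn.
apply: le_trans (unif01_cell N.+1 (cell N.+1 u0)).
apply: le_measure; rewrite ?inE//; first exact: measurable_cell.
by move=> u; apply.
Qed.

(** The exponent [N * N.+1] in the number of cells is quadratic in the level,
    whereas the distance between cells is only exponentially small in it; the
    power [16 ^+ (n.+1 * n.+1)] absorbs the levels below [n]. *)
Lemma mass_decay n : exists2 C : R, 0 < C & forall r u0, 0 <= r < c / 4 ->
  (unif01 (hull r u0) <= (C * r ^+ n.+1)%:E)%E.
Proof.
exists (16 ^+ (n.+1 * n.+1) / (c / 4) ^+ n.+1).
  by rewrite divr_gt0 ?exprn_gt0// divr_gt0.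
move=> r u0 /andP[r0 rc].
have small e : 0 < e -> exists N, c / 4 * a ^+ N < e /\ a ^+ N < e.
  move=> e0; have a1 : `|a| < 1 by rewrite gtr0_norm ?invr_gt0// invf_lt1// ltr1n.
  have /cvgrPdist_lt/(_ _ e0)[k1 _ k1P] := cvg_geometric (c / 4) a1.
  have /cvgrPdist_lt/(_ _ e0)[k2 _ k2P] := cvg_geometric 1 a1.
  exists (maxn k1 k2); have := k1P _ (leq_maxl k1 k2).
  have := k2P _ (leq_maxr k1 k2).
  rewrite /= !sub0r !normrN !gtr0_norm ?mulr_gt0// ?divr_gt0//.
  by rewrite mul1r.
have [->|r_gt0] := eqVneq r 0.
  rewrite expr0n /= mulr0; apply/lee_addgt0Pr => e e0; rewrite add0e.
  have [N [_ Ne]] := small e e0.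
  apply: (le_trans (@unif01_hull 0 u0 N _)); first by rewrite mulr_gt0// divr_gt0.
  rewrite lee_fin (le_trans _ (ltW Ne))// ler_wiXn2l ?invr_ge0// ?invf_le1 ?ler1n//.
  by rewrite mulSn; lia.
have {}r_gt0 : 0 < r by rewrite lt_neqAle eq_sym r_gt0.
have exM : exists M, c / 4 * a ^+ M <= r.
  by have [N [Nr _]] := small r r_gt0; exists N; exact: ltW.
case: (ex_minnP exM) => -[|N] Nr Nmin; first by move: Nr; rewrite mulr1 leNgt rc.
have rN : r < c / 4 * a ^+ N.
  by rewrite ltNge; apply/negP => /Nmin; rewrite ltnn.
apply: (le_trans (unif01_hull u0 rN)); rewrite lee_fin.
have c4 : 0 < c / 4 by rewrite divr_gt0.
apply: (@le_trans _ _ (16 ^+ (n.+1 * n.+1) / (c / 4) ^+ n.+1 *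
    (c / 4 * a ^+ N.+1) ^+ n.+1)); last first.
  rewrite ler_pM2l ?divr_gt0 ?exprn_gt0// lerXn2r// ?nnegrE// mulr_ge0// ltW//.
rewrite [(c / 4 * _) ^+ _]exprMn mulrA divfK ?gt_eqF ?exprn_gt0//.
rewrite -exprM !exprVn ler_pdivlMr ?exprn_gt0// mulrC.
rewrite ler_pdivrMr ?exprn_gt0// -exprD ler_weXn2l ?ler1n//.
by nia.
Qed.

Lemma diam_power_ge0 s (U : set X) : (0 <= diam_power s U)%E.
Proof. by rewrite /diam_power; case: ifP => // _; exact: poweR_ge0. Qed.

(** Mass distribution principle: a cover of [BA] with small [s]-dimensional sum
    would cover a set of parameters of full measure by sets of total measure
    less than 1. *)
Lemma hausdorff_dim_BA : hausdorff_dim BA1 = +oo%E.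
Proof.
rewrite /hausdorff_dim; set S := image _ _.
suff -> : S = set0 by exact: ereal_inf0.
apply/seteqP; split => // x [s [s0 Hs] _].
(* The integer power [(truncn s).+1] exceeds [s], and diameters are at most 1. *)
have [C C0 massC] := mass_decay (Num.truncn s).
have sn : s <= (Num.truncn s).+1%:R by rewrite ltW// truncnS_gt.
pose delta := Num.min (c / 8) 1; have d0 : 0 < delta by rewrite lt_min ltr01 divr_gt0.
have : (hausdorff_content s delta BA1 < C^-1%:E)%E.
  rewrite (@le_lt_trans _ _ 0%E) ?lte_fin ?invr_gt0// -Hs.
  by apply: ereal_sup_ubound; exists delta.
move=> /ereal_inf_lt[_ [U [BAU Udelta] <-]] UC.
have /choice[D DP] k : exists D : set (measurableTypeR R), [/\ measurable D,
    point c z @^-1` U k `<=` D & (unif01 D <= C%:E * diam_power s (U k))%E].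
  have [E0|/set0P[u0 /= Uu0]] := eqVneq (point c z @^-1` U k) set0.
    exists set0; rewrite E0 measure0; split => //.
    by apply: mule_ge0; [rewrite lee_fin ltW|exact: diam_power_ge0].
  have diamP y y' : U k y -> U k y' -> (`|y - y'|%:E <= diam (U k))%E.
    by move=> Uy Uy'; rewrite -edist_normE; apply: ereal_sup_ubound; exists (y, y').
  have diam0 : (0 <= diam (U k))%E.
    by rewrite (le_trans _ (diamP _ _ Uu0 Uu0)).
  have := Udelta k; case diamE : (diam (U k)) diam0 => [r| |]//.
  rewrite !lee_fin => r0 rdelta.
  have [r8 r1] : r <= c / 8 /\ r <= 1 by move: rdelta; rewrite le_min => /andP.
  exists (hull r u0); split; first exact: measurable_hull.
    move=> u /= Uu N /= rN; apply/eqP/negPn/negP => nuu0.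
    have := point_apart c0 z1 zsep nuu0; rewrite leNgt => /negP; apply.
    by apply: le_lt_trans rN; rewrite -lee_fin -diamE diamP.
  have rc : 0 <= r < c / 4 by rewrite r0/=; move: c0 r8; lra.
  apply: (le_trans (massC r u0 rc)).
  rewrite /diam_power ifF; last by apply/negbTE/set0P; exists (point c z u0).
  rewrite diamE poweR_EFin -EFinM lee_fin ler_pM2l//.
  move: r0; rewrite le_eqVlt => /predU1P[<-|r_gt0].
    by rewrite expr0n /= powR_ge0.
  by rewrite -powR_mulrn ?(ltW r_gt0)//; apply: ger_powR; rewrite ?r_gt0.
pose B := point c z @^-1` lim_sup_set (fun N => bad N 0).
have mB : measurable (B : set (measurableTypeR R)).
  rewrite -[X in measurable X]setTI; apply: measurable_point => //.
  apply: bigcap_measurable => // n _; apply: bigcup_measurable => N _.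
  by apply: sub_sigma_algebra; exact: bad_open.
have BD : ~` B `<=` \bigcup_k D k.
  move=> u nBu; have [k _ Uk] : (\bigcup_k U k) (point c z u).
    apply: BAU; apply: contrapT => /(@not_BA_bad 0 _).
    by rewrite addr0; exact: nBu.
  by exists k => //; have [_ + _] := DP k; apply.
have : (unif01 (~` B) <= \sum_(0 <= k <oo) unif01 (D k))%E.
  apply: measure_sigma_subadditive => //; last exact: measurableC.
  by move=> k; have [] := DP k.
rewrite probability_setC// [X in (_ - X)%E](_ : _ = 0%E) ?sube0; last first.
  exact: law_lim_sup_bad 0.
apply/negP; rewrite -ltNge.
apply: (@le_lt_trans _ _ (\sum_(0 <= k <oo) C%:E * diam_power s (U k))%E).
  by apply: lee_nneseries => // k _; have [] := DP k.
rewrite nneseriesZl; last by move=> k _; exact: diam_power_ge0.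
by rewrite muleC -lte_pdivlMr// mul1e.
Qed.

End lattice_avoidance.

(** * Prevalence and dimension of the badly approximable points *)

Theorem theorem4p1 (R : realType) (X : completeNormedModType R) (L : set X)
    (Xinf : infinite_dimensional X) (Llattice : is_lattice L)
    (Lcobounded : cobounded L) :
  prevalent (BA L (fun q : R => q^-1)) /\
  hausdorff_dim (BA L (fun q : R => q^-1)) = +oo%E.
Proof.
have [L_zmod Lisol _] := Llattice.
have L0 : L 0 by have := L_zmod.1; rewrite inE.
have [l l0 L_sep] : exists2 l : R, 0 < l & forall p, L p -> `|p| < l -> p = 0.
  have [_ [V /nbhs_ballP[l /= l0 lV] VL]] := Lisol _ L0.
  exists l => // p Lp pl; suff : (V `&` L) p by rewrite VL.
  by split => //; apply: lV; rewrite -ball_normE/= sub0r normrN.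
have [z [z1 zsep]] := separated_sequence Xinf.
have c0 : 0 < l / 96 by rewrite divr_gt0.
have c_le : 96 * (l / 96) <= l by rewrite mulrC divfK.
split; last exact: hausdorff_dim_BA c0 z1 zsep L_zmod L_sep c_le.
exists (law c0 z1); split; first exact: compactly_supported_law.
exact: transverse_not_BA zsep L_zmod L_sep c_le.
Qed.
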